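(* Let $d \geq 1$ and $0 \leq k \leq d-1$ be integers. Let $\mathcal{F}$ be an infinite family of compact near-balls in $\mathbb{R}^d$ (in the sense defined in the context). Suppose $\mathcal{F}$ satisfies the $(\aleph_0,k+2)$-property with respect to $k$-flats, i.e., among every $\aleph_0$ (countably infinitely many) members of $\mathcal{F}$, some $k+2$ of them can be pierced by a single $k$-flat. Then there is a finite set of $k$-flats in $\mathbb{R}^d$ such that every member of $\mathcal{F}$ intersects at least one of them.
   Context: A $k$-flat in $\mathbb{R}^d$ is a $k$-dimensional affine subspace; a set is pierced by a flat if it has non-empty intersection with it. For a closed ball $D$, $r(D)$ denotes its radius. For a compact set $B \subset \mathbb{R}^d$, $\mathrm{inscr}(B)$ denotes a closed ball of maximum radius contained in $B$, with center $x_B$; $\mathrm{escribed}(B)$ denotes the smallest closed ball centered at $x_B$ containing $B$. If several largest inscribed balls exist, $\mathrm{inscr}(B)$ is chosen so that $r(\mathrm{escribed}(B))$ is minimal (further ties broken arbitrarily). A family $\mathcal{F}$ of non-empty sets in $\mathbb{R}^d$ is a family of near-balls if there is a constant $K=K(\mathcal{F})$ such that for every $B\in\mathcal{F}$: (1) $r(\mathrm{escribed}(B)) \leq K\cdot r(\mathrm{inscr}(B))$, and (2) $r(\mathrm{escribed}(B)) \leq K + r(\mathrm{inscr}(B))$. (Every family of closed balls is a family of near-balls.) *)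

(* Defs.v *)
From mathcomp Require Export all_boot all_order all_algebra.
From mathcomp Require Export all_classical all_reals all_analysis.

Set Implicit Arguments.
Unset Strict Implicit.
Unset Printing Implicit Defensive.

Import Order.TTheory GRing.Theory Num.Theory.
Export numFieldNormedType.Exports.

Local Open Scope classical_set_scope.
Local Open Scope ring_scope.

Section NearBalls.
Variables (R : realType) (d : nat).
Implicit Types (B L : set 'rV[R]_d) (D : 'rV[R]_d * R) (x : 'rV[R]_d).

(* The library norm on matrices is the sup norm; balls here are Euclidean. *)
Definition enorm x : R := Num.sqrt (\sum_(i < d) x 0 i ^+ 2).

(* A pair D stands for the closed ball of center D.1 and radius D.2. *)
Definition eball D : set 'rV[R]_d := [set y | enorm (y - D.1) <= D.2].

(* Radius 0 is allowed: a compact set with empty interior then also has a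
   largest inscribed ball, namely any of its points. *)
Definition largest_inscribed B D : Prop :=
  [/\ 0 <= D.2, eball D `<=` B &
      forall D', 0 <= D'.2 -> eball D' `<=` B -> D'.2 <= D.2].

(* When B is bounded, the infimum is attained. *)
Definition escribed_at x B : 'rV[R]_d * R :=
  (x, inf [set r : R | 0 <= r /\ B `<=` eball (x, r)]).

Definition is_inscr B : set ('rV[R]_d * R) :=
  [set D | largest_inscribed B D /\
    forall D', largest_inscribed B D' ->
      (escribed_at D.1 B).2 <= (escribed_at D'.1 B).2].

(* An arbitrary choice; every non-empty compact B has such a ball (for
   0 < d). *)
Definition inscr B : 'rV[R]_d * R := get (is_inscr B).

Definition escribed B : 'rV[R]_d * R := escribed_at (inscr B).1 B.

(* Meant for families of compact sets, for which inscr and escribed are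
   meaningful. *)
Definition near_balls (F : set (set 'rV[R]_d)) : Prop :=
  (forall B, F B -> B !=set0) /\
  exists K : R, forall B, F B ->
    (escribed B).2 <= K * (inscr B).2 /\ (escribed B).2 <= K + (inscr B).2.

Definition flat (k : nat) L : Prop :=
  exists (p : 'rV[R]_d) (V : {vspace 'rV[R]_d}),
    \dim V = k /\ L = [set p + v | v in [set` V]].

Definition pierced B L : Prop := B `&` L !=set0.

Definition aleph0_property (k q : nat) (F : set (set 'rV[R]_d)) : Prop :=
  forall G : set (set 'rV[R]_d), G `<=` F -> (G #= [set: nat])%card ->
  exists H : set (set 'rV[R]_d), [/\ H `<=` G, (H #= `I_q)%card &
    exists2 L, flat k L & forall B, H B -> pierced B L].

End NearBalls.

(* Main.v *)
Require Import Defs.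
From mathcomp Require Import lra ring zify.

Set Implicit Arguments.
Unset Strict Implicit.
Unset Printing Implicit Defensive.
Import Order.TTheory GRing.Theory Num.Theory.
Local Open Scope classical_set_scope.
Local Open Scope ring_scope.

(** If no finite set of k-flats pierces F, the members of F avoiding finitely
many given k-flats generate a proper filter; let U be an ultrafilter refining
it. By induction on k, for U-almost all B_0, for U-almost all B_1, ..., for
U-almost all B_{k+1}, no k-flat pierces B_0, ..., B_{k+1}; a sequence chosen
greedily then contradicts the (aleph_0, k+2)-property.

For the induction step, the centres of the B converge along U to a point q of
the projective space. Since lines through a point miss almost all B, the
B look small from everywhere, hence converge to q as sets, and their
projections from q (central if q is finite, parallel if q is at infinity) are
again near-balls, missed by every (k-1)-flat. By induction no k-flat through q
pierces B_0, ..., B_k; by compactness the same holds with q replaced by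
anything close to q, in particular by the points of almost every B_{k+1}.

Affine (in)dependence of points y is expressed as linear (in)dependence of
their homogeneous coordinates (1, y), and balls are taken in the sup norm. The
additive condition on near-balls is used only for k = 0; it is weakened there
to the existence, near every point of a large B, of a ball of fixed radius
contained in B, which is stable under linear projections. *)

(** * Sup norm, ultrafilters, and stability of independence *)

Section SupNorm.
Variables (R : realType) (d : nat).
Implicit Types x y : 'rV[R]_d.

Lemma rv_norm_leP x e : 0 <= e -> (forall i, `|x 0 i| <= e) <-> `|x| <= e.
Proof.
move=> e0; have -> : `|x| = mx_norm x by [].
rewrite mx_normrE; split=> [xe|/bigmax_leP[_ xe] i].
  by apply/bigmax_leP; split=> // -[i j] _ /=; rewrite ord1.
exact: (xe (0, i)).
Qed.

Lemma rv_coord_le x i : `|x 0 i| <= `|x|.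
Proof. by have [_ ->] := rv_norm_leP x (normr_ge0 x). Qed.

End SupNorm.

Lemma rv_norm_attained (R : realType) d (x : 'rV[R]_d.+1) :
  exists i, `|x 0 i| = `|x|.
Proof.
have [x0|x0] := eqVneq `|x| 0.
  by exists 0; apply/eqP; rewrite x0 eq_le normr_ge0 -x0 rv_coord_le.
by have [[i j] xij] := mx_norm_neq0 x0; exists j; rewrite [RHS]xij ord1.
Qed.

Section Ultra.
Variables (T : Type) (U : set_system T).
Hypothesis UU : UltraFilter U.

Lemma ultra_orP (P : T -> Prop) :
  (\forall t \near U, P t) \/ (\forall t \near U, ~ P t).
Proof. exact: in_ultra_setVsetC. Qed.

Lemma ultra_fmap (T' : Type) (f : T -> T') : UltraFilter (f @ U).
Proof.
split; first exact: fmap_proper_filter.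
move=> G GF fUG; rewrite predeqE => A; split; last exact: fUG.
move=> GA; have [//|fA] := ultra_orP (fun t => A (f t)).
by have [z []] : A `&` ~` A !=set0 by apply: (@filter_ex _ G); exact: filterI (fUG _ _).
Qed.

(** If each [P i] failed for almost all [t], all would fail at once, there being finitely many. *)
Lemma ultra_finite (n : nat) (P : 'I_n -> T -> Prop) :
  (\forall t \near U, exists i, P i t) -> exists i, \forall t \near U, P i t.
Proof.
move=> ex; apply: contrapT => /forallNP none.
have : \forall t \near U, forall i, ~ P i t.
  by apply: filter_forall => i; have [/none|] := ultra_orP (P i).
by move=> /(filterI ex)/filter_ex[t [[i Pi] /(_ i)]].
Qed.

(** Bolzano-Weierstrass: the image ultrafilter contains a compact ball. *)
Lemma ultra_bounded_cvg (R : realType) (d : nat) (f : T -> 'rV[R]_d) (M : R) :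
  (\forall t \near U, `|f t| <= M) -> exists l : 'rV[R]_d, f @ U --> l.
Proof.
move=> fM; have : compact [set y : 'rV[R]_d | `|y| <= M].
  apply: bounded_closed_compact.
    by exists M; split=> [|x Mx y yM]; [exact: num_real|exact: le_trans yM (ltW Mx)].
  by apply: closed_comp (@closed_le _ M) => y _; exact: norm_continuous.
rewrite compact_ultra => /(_ (f @ U) (ultra_fmap f) fM)[l [_ fl]].
by exists l.
Qed.

End Ultra.

Section Independence.
Variables (R : realType) (E : normedModType R).
Implicit Types (s : seq (set E)) (p : E).

(** For the homogeneous coordinates of [k + 2] sets, this excludes that a [k]-flat pierces them
    all. *)
Definition indep s := forall (y : nat -> E) (c : nat -> R),
  (forall j, (j < size s)%N -> nth set0 s j (y j)) ->
  \sum_(j < size s) c j *: y j = 0 -> forall j, (j < size s)%N -> c j = 0.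

Lemma rV_coord_continuous n (i : 'I_n) :
  continuous (fun v : 'rV[E]_n => v ord0 i).
Proof.
move=> v A /= /nbhs_ballP[e e0 eA].
by apply/nbhs_ballP; exists e => //= w [_ vw]; exact/eA/vw.
Qed.

Lemma lincomb_continuous n :
  continuous (fun u : 'rV[R]_n * 'rV[E]_n => \sum_j u.1 0 j *: u.2 0 j).
Proof.
move=> u; apply: (cvg_big (@add_continuous E)) => j _ /=; apply: cvgZ.
  by apply: (@continuous_comp _ _ _ fst (fun c : 'rV[R]_n => c 0 j));
    [exact: cvg_fst|exact: coord_continuous].
by apply: (@continuous_comp _ _ _ snd (fun v : 'rV[E]_n => v 0 j));
  [exact: cvg_snd|exact: rV_coord_continuous].
Qed.

(** By compactness, combinations with coefficient vector of norm 1 have norm at least some [e > 0],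
    so moving the last vector by less than [e] creates no dependency. The factor [m] reflects that
    homogeneous coordinates matter up to scale. *)
Lemma indep_near s p : {in s, forall A, compact A} ->
  indep (rcons s [set p]) ->
  exists2 e : R, 0 < e & forall A : set E,
    (forall a, A a -> exists2 m : R, m != 0 & `|m *: a - p| < e) ->
    indep (rcons s A).
Proof.
move=> scpt sp; set s' := rcons s _ in sp; set n := size s.
have sz A : size (rcons s A) = n.+1 by rewrite size_rcons.
pose Y := [set v : 'rV[E]_n.+1 | forall j : 'I_n.+1, nth set0 s' j (v ord0 j)].
have cY : compact Y.
  apply: (@rV_compact E n.+1 (fun j => nth set0 s' j)) => j.
  rewrite nth_rcons; case: ltnP => jn; first by apply: scpt; exact: mem_nth.
  by rewrite -/n eqn_leq jn -ltnS ltn_ord; exact: compact_set1.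
pose C := [set c : 'rV[R]_n.+1 | `|c| = 1].
have cC : compact C.
  apply: bounded_closed_compact.
    by exists 1; split=> [|x x1 c /= ->]; [exact: num_real|exact: ltW].
  apply: (@closed_comp _ _ (fun c : 'rV[R]_n.+1 => `|c|) [set 1]) => [c _|].
    exact: norm_continuous.
  exact: closed_eq.
pose f (u : 'rV[R]_n.+1 * 'rV[E]_n.+1) : R := `|\sum_j u.1 0 j *: u.2 0 j|.
have small (A : set E) (y : nat -> E) (c : nat -> R) e :
    (forall a, A a -> exists2 m : R, m != 0 & `|m *: a - p| < e) ->
    (forall j, (j < size (rcons s A))%N -> nth set0 (rcons s A) j (y j)) ->
    \sum_(j < size (rcons s A)) c j *: y j = 0 ->
    (exists2 j, (j < size (rcons s A))%N & c j != 0) ->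
    exists2 u, (C `*` Y) u & f u < e.
  rewrite sz => Ap yA cy0 [j0 j0n cj0].
  have : A (y n) by move: (yA n); rewrite ltnSn nth_rcons ltnn eqxx; exact.
  move=> /Ap[m m0 me].
  (* With its coefficient divided by [m], the last term involves [m *: y n], which is close to
     [p]. *)
  pose b := \row_(j < n.+1) (if (j < n)%N then c j else c n / m).
  have b0 : 0 < `|b|.
    rewrite normr_gt0; apply: contra cj0 => /eqP/rowP/(_ (Ordinal j0n)).
    rewrite !mxE /=; case: ltnP => [_ ->//|nj0].
    have -> : j0 = n by apply/eqP; rewrite eqn_leq nj0 -ltnS j0n.
    by move=> /eqP; rewrite mulf_eq0 invr_eq0 (negPf m0) orbF.
  exists (`|b|^-1 *: b, \row_j (if (j < n)%N then y j else p)).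
    split; first by rewrite /C /= normrZ gtr0_norm ?invr_gt0// mulVf ?gt_eqF.
    move=> j /=; rewrite mxE /s' nth_rcons -/n.
    move: (yA j (ltn_ord j)); rewrite nth_rcons -/n; case: ltnP => // nj _.
    by rewrite eqn_leq nj -ltnS ltn_ord.
  rewrite /f /=; under eq_bigr do rewrite !mxE -scalerA.
  rewrite -scaler_sumr normrZ gtr0_norm ?invr_gt0// mulrC ltr_pdivrMr//.
  rewrite big_ord_recr /= ltnn.
  under eq_bigr do rewrite ltn_ord.
  have -> : \sum_(i < n) c i *: y i = - (c n / m) *: (m *: y n).
    move: cy0; rewrite big_ord_recr /= => /eqP; rewrite addr_eq0 => /eqP ->.
    by rewrite scalerA mulNr divfK // scaleNr.
  rewrite scaleNr addrC -scalerBr -opprB scalerN normrN normrZ mulrC.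
  apply: (@lt_le_trans _ _ (`|m *: y n - p| * `|b| + (e - `|m *: y n - p|) * `|b|)); last first.
    by rewrite -mulrDl addrC subrK.
  rewrite -[X in X < _]addr0 ler_ltD //; last by rewrite mulr_gt0 // subr_gt0.
  rewrite ler_wpM2l //; have := rv_coord_le b ord_max.
  by rewrite mxE /= ltnn.
(* If there is no choice of points at all, there is no dependency either, and any [e] works. *)
have [X0|X0] := pselect ((C `*` Y) !=set0); last first.
  exists 1 => // A Ap y c yA cy j jlt; apply: contrapT => /eqP cj.
  by have [|u Xu _] := small _ _ _ _ Ap yA cy; [exists j|apply: X0; exists u].
have fc : {within C `*` Y, continuous f}.
  apply: continuous_subspaceT => u.
  by apply: (continuous_comp _ (@norm_continuous _ E _)); exact: lincomb_continuous.
have [u0] := compact_EVT_min X0 (compact_setX cC cY) fc.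
rewrite inE => -[/= Cc0 Yv0] fmin.
exists (f u0).
  rewrite normr_gt0; apply/negP => /eqP u00.
  pose g j := u0.1 0 (inord j); pose y j := u0.2 0 (inord j).
  have gE (i : 'I_n.+1) : g i = u0.1 0 i by rewrite /g inord_val.
  have yE (i : 'I_n.+1) : y i = u0.2 0 i by rewrite /y inord_val.
  have g0 : forall j, (j < size s')%N -> g j = 0.
    apply: (sp y) => [j|]; rewrite sz.
      by move=> jn; have /= := Yv0 (Ordinal jn); rewrite -yE.
    by rewrite -[RHS]u00; apply: eq_bigr => i _; rewrite gE yE.
  move: Cc0; rewrite /C /= (_ : u0.1 = 0) ?normr0; last first.
    by apply/rowP => i; rewrite mxE -gE g0 // sz.
  by move/eqP; rewrite eq_sym oner_eq0.
move=> A Ap y c yA cy j jlt; apply: contrapT => /eqP cj.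
have [|u Xu] := small _ _ _ _ Ap yA cy; first by exists j.
by rewrite ltNge fmin // inE.
Qed.

End Independence.

(** * Iterated ultrafilter quantifiers *)

Section IteratedNear.
Variables (T : choiceType) (U : set_system T).
Hypothesis UF : ProperFilter U.

Fixpoint near_iter n (P : seq T -> Prop) : Prop :=
  if n is n'.+1 then \forall t \near U, near_iter n' (fun s => P (t :: s))
  else P [::].

Lemma near_iter_impl n (Q : T -> Prop) (P P' : seq T -> Prop) :
  (\forall t \near U, Q t) ->
  (forall s, size s = n -> (forall t, t \in s -> Q t) -> P s -> P' s) ->
  near_iter n P -> near_iter n P'.
Proof.
move=> UQ; elim: n P P' => [|n IHn] P P' PP' /=; first exact: PP'.
apply: filterS2 UQ => t Qt; apply: IHn => s sn Qs; apply: PP' => [|u].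
  by rewrite /= sn.
by rewrite inE => /predU1P[->|/Qs].
Qed.

(** Gives access to the innermost quantifier, whereas the recursion peels off the outermost. *)
Lemma near_iter_rcons n (P : seq T -> Prop) :
  near_iter n (fun s => \forall t \near U, P (rcons s t)) -> near_iter n.+1 P.
Proof. 
elim: n P => [|n IHn] P //.
move=> Pn; change (\forall t \near U, near_iter n.+1 (fun s => P (t :: s))).
apply: filterS (Pn : U (fun t => near_iter n (fun s => \forall u \near U, P (t :: rcons s u)))).
by move=> t; exact: (IHn (fun s => P (t :: s))). Qed.

(** Greedy choice: each subsequence, of length at most [n], of the list built so far can still be
    completed almost everywhere. This puts finitely many conditions on the next entry. *)
Lemma near_iter_sequence n (P : seq T -> Prop) : near_iter n P ->
  exists f : nat -> T, forall s : seq nat,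
    sorted ltn s -> size s = n -> P (map f s).
Proof.
move=> Pn.
pose good l := forall r, subseq r l -> (size r <= n)%N ->
  near_iter (n - size r) (fun u => P (r ++ u)).
have good0 : good [::] by move=> r; rewrite subseq0 => /eqP-> _ /=; rewrite subn0.
have goodS l : good l -> exists t, good (rcons l t).
  move=> gl; suff : \forall t \near U, good (rcons l t) by exact: filter_ex.
  (* Subsequences are indexed by Boolean masks, which form a finite type. *)
  have : \forall t \near U, forall m : (size l).-tuple bool,
      (size (mask m l) < n)%N ->
      near_iter (n - (size (mask m l)).+1) (fun u => P (mask m l ++ t :: u)).
    apply: filter_forall => m.
    case: (ltnP (size (mask m l)) n) => [mn|_]; last exact: nearW.
    have := gl _ (mask_subseq m l) (ltnW mn).
    have -> : (n - size (mask m l) = (n - (size (mask m l)).+1).+1)%N by lia.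
    by move=> /= gm; apply: (filterS _ gm).
  apply: filterS => t gt r /subseqP[m]; rewrite size_rcons.
  case/lastP: m => // m b; rewrite size_rcons => -[ml] ->.
  rewrite mask_rcons //; case: b => /=; last by rewrite cats0; exact/gl/mask_subseq.
  rewrite size_cat addn1 => mn; have := gt (tcast ml (in_tuple m)).
  by rewrite val_tcast /= => /(_ mn); under [in X in _ -> X]eq_fun do rewrite -catA.
have /choice[g gP] : forall l, exists t, good l -> good (rcons l t).
  move=> l; have [/goodS[t gt]|nl] := pselect (good l); first by exists t.
  by have [t _] := @filter_ex _ U _ _ filterT; exists t.
pose L := fix L k := if k is k'.+1 then rcons (L k') (g (L k')) else [::].
exists (g \o L) => s srt sn.
have LE k : L k = map (g \o L) (iota 0 k).
  elim: k => // k IHk; rewrite -[in iota _ _]addn1 iotaD map_cat -IHk cats1.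
  by [].
have goodL k : good (L k) by elim: k => //= k; exact: gP.
pose N := (\max_(i <- s) i.+1)%N.
(* An increasing list of indices is a subsequence of an initial segment of the naturals. *)
have sN : subseq s (iota 0 N).
  rewrite (_ : s = [seq i <- iota 0 N | i \in s]); first exact: filter_subseq.
  apply: (irr_sorted_eq ltn_trans ltnn) => //.
    by apply: sorted_filter; [exact: ltn_trans|exact: iota_ltn_sorted].
  move=> i; rewrite mem_filter mem_iota add0n /=.
  by case: (boolP (i \in s)) => //= si; apply/esym/(@leq_bigmax_seq _ s predT succn).
have /goodL : subseq (map (g \o L) s) (L N) by rewrite LE map_subseq.
by rewrite size_map sn subnn => /(_ (leqnn _)) /=; rewrite cats0.
Qed.

End IteratedNear.

(** * Sets sandwiched between balls *)

Section Homogenization.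
Variables (R : realType) (d : nat).
Implicit Types (B : set 'rV[R]_d).

Definition homog B : set (R^o * 'rV[R]_d)%type := [set ((1 : R^o), y) | y in B].

(** The rows of [M] may be dependent: the dimension is at most [k], and points and lines are covered
    too. *)
Definition pflat k (p : 'rV[R]_d) (M : 'M[R]_(k, d)) : set 'rV[R]_d :=
  [set p + a *m M | a in [set: 'rV[R]_k]].

Lemma pflat_base k (p : 'rV[R]_d) (M : 'M[R]_(k, d)) : pflat p M p.
Proof. by exists 0 => //; rewrite mul0mx addr0. Qed.

Lemma pflat_line k (p u : 'rV[R]_d) (a : R) :
  pflat p (\matrix_(i < k.+1) u) (p + a *: u).
Proof.
by exists (a *: delta_mx 0 0) => //; rewrite -scalemxAl -rowE rowK.
Qed.

Lemma compact_homog B : compact B -> compact (homog B).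
Proof.
apply: continuous_compact; apply: continuous_subspaceT => y.
by apply: (@cvg_pair _ _ _ (nbhs y) (nbhs (1 : R^o)) (nbhs y));
  [exact: cvg_cst|exact: cvg_id].
Qed.

Lemma indep_homog2 B B' : (forall y, B y -> ~ B' y) ->
  indep [:: homog B; homog B'].
Proof.
move=> BB' y c yB; rewrite big_ord_recl big_ord1 /=.
have [/= b Bb yb] := yB 0 isT; have [/= b' Bb' yb'] := yB 1 isT.
rewrite -yb -yb' => -[cc].
have c1 : c 1 = - c 0.
  by move: cc; rewrite /GRing.scale /= !mulr1 => /eqP; rewrite addrC addr_eq0 => /eqP.
rewrite c1 scaleNr -scalerBr => /eqP; rewrite scaler_eq0 subr_eq0 => /orP[/eqP c0|/eqP bb'].
  by case=> [|[|]] // _; rewrite ?c1 c0 ?oppr0.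
by case: (BB' b); rewrite // bb'.
Qed.

(** The last clause is the weakened additive condition. It becomes void under the central
    projections used below, which make [r] smaller than 1. *)
Definition round (K e s : R) B x r := [/\ compact B, 0 <= r,
  forall y, `|y - x| <= r -> B y, forall y, B y -> `|y - x| <= K * r &
  1 <= r -> forall y, B y ->
    exists2 z, `|z - y| <= s & forall w, `|w - z| <= e -> B w].

End Homogenization.

Lemma pair_norm_lt (R : realType) d (a : R^o) (y : 'rV[R]_d) (e : R) :
  `|a| < e -> `|y| < e -> `|(a, y)| < e.
Proof. by move=> ae ye; rewrite prod_normE /= gt_max ae ye. Qed.

(** Applying [g] to a relation removes the term of [q]; the other coefficients vanish by
    independence of the images, and then so does that of [q]. The factors [a] serve to normalize
    first coordinates to 1. *)
Lemma indep_proj (R : realType) (E E' : normedModType R) (g : E -> E')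
    (s : seq (set E)) (s' : seq (set E')) (q : E) :
  linear g -> g q = 0 -> q != 0 -> size s' = size s ->
  (forall j, (j < size s)%N -> forall y, nth set0 s j y ->
    exists2 a : R, a != 0 & nth set0 s' j (a *: g y)) ->
  indep s' -> indep (rcons s [set q]).
Proof.
move=> gl gq q0 szs ss' s'i y c; rewrite size_rcons; set n := size s => ys.
have g0 : g 0 = 0 by rewrite -[X in g X](subrr q) -scaleN1r addrC gl gq scaler0 addr0.
have gsum : g (\sum_(j < n.+1) c j *: y j) = \sum_(j < n.+1) c j *: g (y j).
  elim: n.+1 => [|m IHm]; first by rewrite !big_ord0.
  by rewrite !big_ord_recr /= addrC gl IHm addrC.
have yn : y n = q by move: (ys n (ltnSn n)); rewrite nth_rcons ltnn eqxx.
move=> cy0; have := gsum; rewrite cy0 g0 big_ord_recr /= yn gq scaler0 addr0.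
have /choice[a aP] : forall j, exists a : R, (j < n)%N ->
    a != 0 /\ nth set0 s' j (a *: g (y j)).
  move=> j; case: (ltnP j n) => [jn|]; last by exists 0.
  have := ys j (leqW jn); rewrite nth_rcons jn => /(ss' j jn)[a a0 as'].
  by exists a.
move=> gy0; have cn : forall j, (j < n)%N -> c j = 0.
  move=> j jn; have [aj0 _] := aP j jn.
  have /eqP : c j / a j = 0; last first.
    by rewrite mulf_eq0 invr_eq0 (negPf aj0) orbF => /eqP.
  apply: (s'i (fun j => a j *: g (y j)) (fun j => c j / a j)); rewrite ?szs //.
    by move=> i /aP[].
  rewrite [RHS]gy0; apply: eq_bigr => i _; rewrite scalerA divfK //.
  by have [] := aP i (ltn_ord i).
move=> j; rewrite ltnS leq_eqVlt => /orP[/eqP->|/cn//].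
move: cy0; rewrite big_ord_recr /= big1 ?add0r => [|i _]; last by rewrite cn ?scale0r.
by rewrite yn => /eqP; rewrite scaler_eq0 (negPf q0) orbF => /eqP.
Qed.

(** * Families of round sets along an ultrafilter *)

Section Piercing.
Variables (R : realType) (T : choiceType) (U : set_system T).
Hypothesis UU : UltraFilter U.

Definition misses d k (B : T -> set 'rV[R]_d) :=
  forall p (M : 'M[R]_(k, d)), \forall t \near U, forall y, B t y -> ~ pflat p M y.

Lemma misses_point d k (B : T -> set 'rV[R]_d) p : misses k B ->
  \forall t \near U, ~ B t p.
Proof.
by move=> /(_ p 0); apply: filterS => t Bp /Bp; apply; exact: pflat_base.
Qed.

(** The limit of the bounded centres lies in almost all of the balls of fixed radius around them. *)
Lemma bounded_ball_hit d (B : T -> set 'rV[R]_d) (z : T -> 'rV[R]_d) M e :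
  0 < e -> (\forall t \near U, `|z t| <= M) ->
  (\forall t \near U, forall w, `|w - z t| <= e -> B t w) ->
  exists p, \forall t \near U, B t p.
Proof.
move=> e0 /(ultra_bounded_cvg UU)[l /cvgrPdist_le zl] Bz; exists l.
by apply: filterS2 (zl _ e0) Bz => t lz; exact.
Qed.

Section Family.
Variables (d : nat) (B : T -> set 'rV[R]_d) (x : T -> 'rV[R]_d) (r : T -> R).
Variables (K e s : R).
Hypotheses (K1 : 1 <= K) (e0 : 0 < e).
Hypothesis Br : \forall t \near U, round K e s (B t) (x t) (r t).

(** Otherwise almost all [B t] contain a ball of fixed radius with bounded centre: around [x t] if
    [r t < 1], and from the last clause of [round] if not. A single point would then lie in almost
    all [B t]. *)
Lemma small_near_bounded k M : misses k B ->
  (\forall t \near U, exists2 y, B t y & `|y| <= M) ->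
  forall a, 0 < a -> \forall t \near U, r t < a.
Proof.
move=> mB BM a a0; have [//|ra] := ultra_orP UU (fun t => r t < a).
exfalso; suff [p Bp] : exists p, \forall t \near U, B t p.
  by have [t []] := filter_ex (filterI Bp (misses_point p mB)).
have [r1|r1] := ultra_orP UU (fun t => 1 <= r t).
  pose P t z := `|z| <= M + s /\ (forall w, `|w - z| <= e -> B t w).
  have exz : \forall t \near U, exists z, P t z.
    near=> t; have [_ _ _ _ big] : round K e s (B t) (x t) (r t) by near: t.
    have [y By yM] : exists2 y, B t y & `|y| <= M by near: t.
    have r1t : 1 <= r t by near: t.
    have [z zy zB] := big r1t _ By; exists z; split => //.
    by rewrite -(subrK y z) addrC (le_trans (ler_normD _ _))// lerD.
  apply: (@bounded_ball_hit _ B (fun t => get (P t)) (M + s) e e0).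
    by apply: filterS exz => t /getPex[].
  by apply: filterS exz => t /getPex[].
apply: (@bounded_ball_hit _ B x (M + K) a a0).
  near=> t; have [_ r0 _ Bx _] : round K e s (B t) (x t) (r t) by near: t.
  have [y By yM] : exists2 y, B t y & `|y| <= M by near: t.
  have /negP : ~ 1 <= r t by near: t.
  rewrite -ltNge => r1t; rewrite -(subrK y (x t)) addrC (le_trans (ler_normD _ _))//.
  rewrite lerD// distrC (le_trans (Bx _ By))// ler_piMr ?(ltW r1t)//.
  exact: le_trans K1.
near=> t; have [_ r0 xB _ _] : round K e s (B t) (x t) (r t) by near: t.
have /negP : ~ r t < a by near: t.
by rewrite -leNgt => ar w wx; apply: xB; exact: le_trans ar.
Unshelve. all: by end_near. Qed.

(** Sets that keep meeting a fixed ball shrink to a point [p], which has positive distance from the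
    closed set [B t]. Otherwise the sets leave every ball, in particular one around the bounded set
    [B t]. Either way almost all [B t'] are disjoint from [B t]. *)
Lemma indep_points : misses 0 B ->
  near_iter U 2 (fun l => indep [seq homog (B t) | t <- l]).
Proof.
move=> mB; have [M0|nM] := pselect (exists M, \forall t \near U, exists2 y, B t y & `|y| <= M).
  have [M BM] := M0.
  have rsmall := small_near_bounded mB BM.
  have [|p /cvgrPdist_lt xp] := @ultra_bounded_cvg _ _ UU R d x (M + K).
    near=> t; have [_ r0 _ Bx _] : round K e s (B t) (x t) (r t) by near: t.
    have [y By yM] : exists2 y, B t y & `|y| <= M by near: t.
    have r1t : r t < 1 by near: t; exact: rsmall.
    rewrite -(subrK y (x t)) addrC (le_trans (ler_normD _ _))//.
    rewrite lerD// distrC (le_trans (Bx _ By))// ler_piMr ?(ltW r1t)//.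
    exact: le_trans K1.
  rewrite /=; near=> t.
  have [Bt _ _ _ _] : round K e s (B t) (x t) (r t) by near: t.
  have Btp : ~ B t p by near: t; exact: misses_point mB.
  have /nbhs_ballP[a /= a0 pa] : nbhs p (~` B t).
    apply: open_nbhs_nbhs; split=> //; apply: closed_openC.
    by apply: compact_closed => //; exact: norm_hausdorff.
  near=> t'; apply: indep_homog2 => y By By'.
  have [_ _ _ Bx _] : round K e s (B t') (x t') (r t') by near: t'.
  apply: (pa y) By; rewrite -ball_normE /=.
  have : `|p - x t'| < a / 2 by near: t'; apply: xp; rewrite divr_gt0.
  have : r t' < a / 2 / K by near: t'; apply: rsmall; rewrite !divr_gt0 // (lt_le_trans ltr01).
  rewrite ltr_pdivlMr ?(lt_le_trans ltr01)// mulrC => ra pxa.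
  have := Bx _ By'; have := ler_distD (x t') p y; rewrite (distrC (x t')).
  lra.
rewrite /=; near=> t.
have [/compact_bounded[M [_ BM]] _ _ _ _] : round K e s (B t) (x t) (r t) by near: t.
near=> t'; apply: indep_homog2 => y By By'.
have : ~ exists2 y, B t' y & `|y| <= M + 1.
  near: t'; have [h|//] := ultra_orP UU (fun t' => exists2 y, B t' y & `|y| <= M + 1).
  by case: nM; exists (M + 1).
by apply; exists y => //; apply: BM => //; rewrite ltrDl.
Unshelve. all: by end_near. Qed.

(** Otherwise let [l] be the limit of the unit vectors from [p] towards [x t]. On the line through
    [p] with direction [l], the point with parameter [|x t - p|] is within [r t] of [x t], so the
    line meets [B t]. *)
Lemma thin_from_point k : misses k.+1 B -> forall p a, 0 < a ->
  \forall t \near U, r t < a * `|x t - p|.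
Proof.
move=> mB p a a0; have [//|ra] := ultra_orP UU (fun t => r t < a * `|x t - p|).
exfalso; pose u t := `|x t - p|^-1 *: (x t - p).
have [|l /cvgrPdist_le ul] := @ultra_bounded_cvg _ _ UU R d u 1.
  (* Where [x t = p], the inverse is 0 by convention and the bound still holds. *)
  apply: nearW => t; rewrite normrZ normfV normr_id.
  have [->|xp0] := eqVneq `|x t - p| 0; first by rewrite invr0 mul0r.
  by rewrite mulVf.
have [t [[[[_ r0 xB _ _] /(_ (p + `|x t - p| *: l)) BL] Bp] [/negP rat lu]]] :=
  filter_ex (filterI (filterI (filterI Br (mB p (\matrix_(i < k.+1) l)))
  (misses_point p mB)) (filterI ra (ul _ a0))).
rewrite -leNgt in rat; apply: BL; last exact: pflat_line.
apply: xB; apply: le_trans rat.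
have [xp|xp0] := eqVneq `|x t - p| 0.
  rewrite xp scale0r addr0 mulr0.
  by rewrite distrC xp.
rewrite (_ : p + _ - _ = `|x t - p| *: (l - u t)).
  by rewrite normrZ normr_id mulrC ler_wpM2r.
by rewrite scalerBr /u scalerA divff // scale1r opprB addrCA addrA.
Qed.

(** [q] is the projective limit of the sets, [g] the projection from [q] and [pr] its affine form.
    Independence of the projections gives independence together with [q] by [indep_proj];
    [indep_near] then replaces [q] by sets close to it. *)
Lemma indep_step d' k (g : R^o * 'rV[R]_d -> R^o * 'rV[R]_d')
    (pr : 'rV[R]_d -> 'rV[R]_d') (q : R^o * 'rV[R]_d) :
  linear g -> g q = 0 -> q != 0 ->
  (\forall t \near U, forall y, B t y ->
     exists2 a : R, a != 0 & a *: g (1, y) = (1, pr y)) ->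
  (forall a, 0 < a -> \forall t \near U, forall y, B t y ->
     exists2 m : R, m != 0 & `|m *: ((1 : R^o), y) - q| < a) ->
  near_iter U k (fun l => indep [seq homog (pr @` B t) | t <- l]) ->
  near_iter U k.+1 (fun l => indep [seq homog (B t) | t <- l]).
Proof.
move=> gl gq q0 gpr Bq IH; apply: near_iter_rcons.
apply: (near_iter_impl _ (filterI Br gpr) _ IH) => l _ lQ li.
have [||a a0 near_a] := @indep_near R _ [seq homog (B t) | t <- l] q.
- by move=> _ /mapP[t /lQ[[cB _ _ _ _] _] ->]; exact: compact_homog.
- apply: indep_proj gl gq q0 _ _ li; first by rewrite !size_map.
  rewrite size_map => j jl y; have [t0 _] := filter_ex gpr.
  rewrite !(nth_map t0) // => -[b Bb <-].
  have [_ /(_ _ Bb)[c c0 cE]] := lQ _ (mem_nth t0 jl).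
  by exists c => //; rewrite cE; exists (pr b) => //; exists b.
apply: filterS (Bq _ a0) => t Bt; rewrite map_rcons; apply: near_a.
by move=> _ [y /Bt[m m0 my] <-]; exists m.
Qed.

End Family.
End Piercing.

(** * Projections from a point *)

Lemma cvg_row (R : realType) (T : Type) (F : set_system T) {FF : Filter F} d
    (f : T -> 'rV[R]_d) (l : 'rV[R]_d) :
  (forall j, f t 0 j @[t --> F] --> l 0 j) -> f @ F --> l.
Proof.
move=> fl; apply/cvgrPdist_le => e e0.
have : \forall t \near F, forall j, `|l 0 j - f t 0 j| <= e.
  by apply: filter_forall => j; move/cvgrPdist_le: (fl j); exact.
by apply: filterS => t lt; apply/rv_norm_leP => [|j]; [exact: ltW|rewrite !mxE].
Qed.

Lemma continuous_at_row (R : realType) (X : topologicalType) d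
    (f : X -> 'rV[R]_d) (y : X) :
  (forall j, continuous_at y (fun t => f t 0 j)) -> continuous_at y f.
Proof. exact: (@cvg_row _ _ _ (nbhs_filter y)). Qed.

Section Projections.
Variables (R : realType) (d : nat) (i : 'I_d.+1).
Implicit Types (y u p : 'rV[R]_d.+1) (z : 'rV[R]_d).

Definition insert m (a : R) (z : 'M[R]_(m, d)) : 'M[R]_(m, d.+1) :=
  \matrix_(h, l) (if unlift i l is Some j then z h j else a).

Lemma insertE m a (z : 'M[R]_(m, d)) h : insert a z h i = a.
Proof. by rewrite mxE unlift_none. Qed.

Lemma insert_lift m a (z : 'M[R]_(m, d)) h j : insert a z h (lift i j) = z h j.
Proof. by rewrite mxE liftK. Qed.

Definition inserts := (insertE, insert_lift).

Lemma row_ext y y' : y 0 i = y' 0 i ->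
  (forall j, y 0 (lift i j) = y' 0 (lift i j)) -> y = y'.
Proof. by move=> yi yj; apply/rowP => l; case: (unliftP i l) => [j|] ->. Qed.

Lemma norm_row_le y e : 0 <= e -> `|y 0 i| <= e ->
  (forall j, `|y 0 (lift i j)| <= e) -> `|y| <= e.
Proof.
by move=> e0 yi yj; apply/rv_norm_leP => // l; case: (unliftP i l) => [j|] ->.
Qed.

Lemma mulmx_insert0 m (a : 'rV[R]_m) (M : 'M[R]_(m, d)) :
  a *m insert 0 M = insert 0 (a *m M).
Proof.
apply: row_ext => [|j]; rewrite !inserts !mxE.
  by apply: big1 => h _; rewrite insertE mulr0.
by apply: eq_bigr => h _; rewrite insert_lift.
Qed.

(** Projection from [p] to the hyperplane where coordinate [i] exceeds that of [p] by 1; [p] becomes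
    the origin and coordinate [i] is dropped. *)
Definition central p y : 'rV[R]_d :=
  \row_j ((y 0 (lift i j) - p 0 (lift i j)) / (y 0 i - p 0 i)).

(** For [u 0 i = 1], projection along [u] to the hyperplane where coordinate [i] is 0. *)
Definition parallel u y : 'rV[R]_d :=
  \row_j (y 0 (lift i j) - y 0 i * u 0 (lift i j)).

(** The cone from [p] over a flat lies in a flat of one dimension more; hence projections inherit
    [misses] with [k] lowered by 1. *)
Lemma central_pflat k p (p' : 'rV[R]_d) (M : 'M[R]_(k, d)) y :
  y 0 i != p 0 i -> pflat p' M (central p y) ->
  pflat p (col_mx (insert 1 p') (insert 0 M) : 'M[R]_(1 + k, d.+1)) y.
Proof.
move=> yp [a _ /rowP yE]; set b := y 0 i - p 0 i.
have b0 : b != 0 by rewrite subr_eq0.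
exists (row_mx b%:M (b *: a)) => //.
rewrite mul_row_col mul_scalar_mx mulmx_insert0 -scalemxAl.
apply: row_ext => [|j].
  by rewrite !mxE !unlift_none mulr1 addr0 addrC subrK.
have := yE j; rewrite !mxE !liftK -/b => yj.
by rewrite !mxE -mulrDr yj mulrC divfK // addrC subrK.
Qed.

(** The analogue for the cylinder over a flat in direction [u]. *)
Lemma parallel_pflat k u (p' : 'rV[R]_d) (M : 'M[R]_(k, d)) y :
  u 0 i = 1 -> pflat p' M (parallel u y) ->
  pflat (insert 0 p') (col_mx u (insert 0 M) : 'M[R]_(1 + k, d.+1)) y.
Proof.
move=> ui [a _ /rowP yE].
exists (row_mx (y 0 i)%:M a) => //.
rewrite mul_row_col mul_scalar_mx mulmx_insert0.
apply: row_ext => [|j].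
  by rewrite !mxE !unlift_none ui mulr1 addr0 add0r.
have := yE j; rewrite !mxE !liftK => yj.
by rewrite addrCA ?mxE yj addrC subrK.
Qed.

(** Linear lift of [central p] to homogeneous coordinates. *)
Definition centralg p (v : R^o * 'rV[R]_d.+1) : R^o * 'rV[R]_d :=
  (v.2 0 i - v.1 * p 0 i,
   \row_j (v.2 0 (lift i j) - v.1 * p 0 (lift i j))).

Lemma centralg_linear p : linear (centralg p).
Proof.
move=> a [b y] [c z]; congr pair => /=.
  by rewrite !mxE /GRing.scale /=; ring.
by apply/rowP => j; rewrite !mxE /GRing.scale /=; ring.
Qed.

Lemma centralg_center p : centralg p (1, p) = 0.
Proof.
congr pair => /=; first by rewrite mul1r subrr.
by apply/rowP => j; rewrite !mxE mul1r subrr.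
Qed.

Lemma centralgE p y : y 0 i != p 0 i ->
  (y 0 i - p 0 i)^-1 *: centralg p (1, y) = (1, central p y).
Proof.
move=> yp; congr pair => /=.
  by rewrite mul1r /GRing.scale /= mulVf // subr_eq0.
by apply/rowP => j; rewrite !mxE mul1r mulrC.
Qed.

(** Linear lift of [parallel u]; for [u 0 i = 1] it kills [(0, u)], the point at infinity in
    direction [u]. *)
Definition parallelg u (v : R^o * 'rV[R]_d.+1) : R^o * 'rV[R]_d :=
  (v.1, parallel u v.2).

Lemma parallelg_linear u : linear (parallelg u).
Proof.
move=> a [b y] [c z]; congr pair => /=.
by apply/rowP => j; rewrite !mxE /=; ring.
Qed.

Lemma parallelg_center u : u 0 i = 1 -> parallelg u (0, u) = 0.
Proof.
by move=> ui; congr pair; apply/rowP => j; rewrite !mxE ui mul1r subrr.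
Qed.

(** The projection is 2-Lipschitz as [|u| <= 1], which doubles [K] and [s]; images of balls contain
    balls of the same radius, which keeps [r] and [e]. *)
Lemma round_parallel K e s (B : set 'rV[R]_d.+1) x r u :
  u 0 i = 1 -> `|u| <= 1 -> round K e s B x r ->
  round (2 * K) e (2 * s) (parallel u @` B) (parallel u x) r.
Proof.
move=> ui u1 [cB r0 xB Bx big].
have lift_hit w y a : (forall v, `|v - y| <= a -> B v) -> `|w - parallel u y| <= a ->
    (parallel u @` B) w.
  move=> yB wa; have a0 : 0 <= a by exact: le_trans wa.
  (* This lift of [w] keeps coordinate [i] of [y], so it is as close to [y] as [w] is to the
     projection of [y]. *)
  exists (y + insert 0 (w - parallel u y)).
    apply: yB; rewrite addrAC subrr add0r; apply: norm_row_le => // [|j].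
      by rewrite inserts normr0.
    by rewrite inserts; move/(rv_norm_leP _ a0): wa; exact.
  apply/rowP => j; rewrite !mxE liftK unlift_none addr0 !mxE; ring.
have par2 y y' : `|parallel u y - parallel u y'| <= 2 * `|y - y'|.
  apply/rv_norm_leP => [|j]; first by rewrite mulr_ge0.
  rewrite !mxE (_ : _ - _ = (y - y') 0 (lift i j) - (y - y') 0 i * u 0 (lift i j)); last first.
    by rewrite !mxE; ring.
  rewrite (le_trans (ler_normB _ _))// mulrDl mul1r lerD ?rv_coord_le//.
  by rewrite normrM -[leRHS]mulr1 ler_pM ?rv_coord_le// (le_trans (rv_coord_le _ _)).
split => //.
- apply: continuous_compact => //; apply: continuous_subspaceT => y.
  apply: continuous_at_row => j; under eq_fun do rewrite mxE.
  have crd : z 0 (lift i j) - z 0 i * u 0 (lift i j) @[z --> y] -->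
      y 0 (lift i j) - y 0 i * u 0 (lift i j).
    apply: cvgB; first exact: coord_continuous.
    by apply: cvgM; [exact: coord_continuous|exact: cvg_cst].
  exact: crd.
- by move=> w; exact: lift_hit.
- by move=> _ [y By <-]; rewrite (le_trans (par2 _ _))// -mulrA ler_pM2l// Bx.
- move=> r1 _ [y By <-]; have [z zy zB] := big r1 _ By.
  exists (parallel u z); first by rewrite (le_trans (par2 _ _))// ler_pM2l.
  by move=> w; exact: lift_hit.
Qed.

(** Coordinate [i] realizes the distance from [p] to [x], and [y] is within [K * r], less than a
    quarter of it, of [x]. *)
Lemma central_bounds K e s (B : set 'rV[R]_d.+1) x r p :
  round K e s B x r -> `|x 0 i - p 0 i| = `|x - p| -> 4 * K * r < `|x - p| ->
  forall y, B y -> 3 / 4 * `|x - p| <= `|y 0 i - p 0 i|.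
Proof.
move=> [_ _ _ Bx _] xip rx y By.
have := Bx _ By; have := rv_coord_le (y - x) i; rewrite !mxE.
have := ler_distD (y 0 i) (x 0 i) (p 0 i); rewrite xip (distrC (x 0 i)).
lra.
Qed.

(** The new radius is less than 1, so the last clause of [round] is void and its constants 1 are
    arbitrary. *)
Lemma round_central K e s (B : set 'rV[R]_d.+1) x r p :
  1 <= K -> round K e s B x r ->
  `|x 0 i - p 0 i| = `|x - p| -> 4 * K * r < `|x - p| ->
  round (4 * K) 1 1 (central p @` B) (central p x) (r / `|x - p|).
Proof.
move=> K1 Brd xip rx; have far := central_bounds Brd xip rx.
have [cB r0 xB Bx _] := Brd; set D := `|x - p| in xip rx far *.
have Kr : 0 <= 4 * K * r by rewrite !mulr_ge0// (le_trans ler01).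
have D0 : 0 < D by exact: le_lt_trans rx.
have xip0 : x 0 i - p 0 i != 0 by rewrite -normr_gt0 xip.
have yip0 y : B y -> y 0 i - p 0 i != 0.
  by move=> /far yD; rewrite -normr_gt0; lra.
have rD : r / D < 1 by rewrite ltr_pdivrMr// mul1r; nra.
split.
- apply: continuous_compact => //; apply: continuous_in_subspaceT => y.
  rewrite inE => By; apply: continuous_at_row => j.
  under eq_fun do rewrite mxE.
  have crd l : z 0 l - p 0 l @[z --> y] --> y 0 l - p 0 l.
    by apply: cvgB; [exact: coord_continuous|exact: cvg_cst].
  have cV : (z 0 i - p 0 i)^-1 @[z --> y] --> (y 0 i - p 0 i)^-1.
    by apply: cvgV; [exact: yip0|exact: crd].
  exact: (cvgM (crd (lift i j)) cV).
- by rewrite divr_ge0// ltW.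
(* The lift of [w] is taken in the hyperplane through [x] where coordinate [i] is constant; there
   the projection divides distances by [D]. *)
- move=> w wr; exists (p + (x 0 i - p 0 i) *: insert 1 w).
    apply: xB; apply: norm_row_le => // [|j].
      rewrite !mxE unlift_none mulr1.
      by rewrite (addrC (p 0 i)) subrK subrr normr0.
    have rD0 : 0 <= r / D by rewrite divr_ge0// ltW.
    move/(rv_norm_leP _ rD0): wr => /(_ j); rewrite ler_pdivlMr//.
    apply: le_trans; rewrite -xip -normrM !mxE liftK.
    rewrite le_eqVlt; apply/orP; left; apply/eqP; congr (`|_|).
    by field.
  apply/rowP => j; rewrite !mxE liftK unlift_none.
  by rewrite mulr1 [X in X / _]addrAC [X in _ / X]addrAC !subrr !add0r mulrC mulKf.
- move=> _ [y By <-].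
  have yD := far _ By; have y0 := yip0 _ By; have yx := Bx _ By.
  apply/rv_norm_leP => [|j].
    by rewrite !mulr_ge0 ?invr_ge0//; [exact: le_trans K1|exact: ltW].
  rewrite !mxE; set a := y 0 (lift i j) - _; set b := y 0 i - _.
  set a' := x 0 (lift i j) - _; set b' := x 0 i - _.
  (* The numerator is at most [2 K r D] and [|b|] at least [3/4 D], which leaves room for the factor
     4. *)
  have -> : a / b - a' / b' = ((a - a') * b' - a' * (b - b')) / (b * b') by field; apply/andP.
  rewrite normrM normfV normrM xip ler_pdivrMr; last by rewrite mulr_gt0//; lra.
  have aa : `|a - a'| <= K * r.
    by rewrite /a /a' opprB addrA subrK (le_trans _ yx)//;
      have := rv_coord_le (y - x) (lift i j); rewrite !mxE.
  have bb : `|b - b'| <= K * r.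
    by rewrite /b /b' opprB addrA subrK (le_trans _ yx)//;
      have := rv_coord_le (y - x) i; rewrite !mxE.
  have a'D : `|a'| <= D by have := rv_coord_le (x - p) (lift i j); rewrite !mxE.
  apply: (@le_trans _ _ (2 * (K * r) * D)).
    rewrite (le_trans (ler_normB _ _))// !normrM xip mulrDl mul1r mulrDl lerD//.
      by rewrite ler_wpM2r// ltW.
    by rewrite [leRHS]mulrC ler_pM.
  rewrite (_ : 4 * K * (r / D) * (`|b| * D) = 4 * (K * r) * `|b|); last first.
    by field; rewrite gt_eqF.
  have KR : 0 <= K * r by lra.
  have := mulr_ge0 KR (ltW D0); have := ler_wpM2l KR yD; rewrite -/b; lra.
- by move=> /(lt_le_trans rD); rewrite ltxx.
Qed.

End Projections.

(** * Induction on the dimension of the flats *)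

Section NearIndependence.
Variables (R : realType) (T : choiceType) (U : set_system T).
Hypothesis UU : UltraFilter U.

(** The family and its constants are quantified because projecting changes them. *)
Definition near_indep_at d k := forall (B : T -> set 'rV[R]_d) x r K e s,
  1 <= K -> 0 < e -> (\forall t \near U, round K e s (B t) (x t) (r t)) ->
  misses U k B ->
  near_iter U k.+2 (fun l => indep [seq homog (B t) | t <- l]).

Section Step.
Variables (d k : nat) (IH : near_indep_at d k).
Variables (B : T -> set 'rV[R]_d.+1) (x : T -> 'rV[R]_d.+1) (r : T -> R).
Variables (K e s : R).
Hypotheses (K1 : 1 <= K) (e0 : 0 < e).
Hypothesis Br : \forall t \near U, round K e s (B t) (x t) (r t).
Hypothesis mB : misses U k.+1 B.

Let K0 : 0 < K. Proof. exact: lt_le_trans K1. Qed.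

(** The sup norm is attained at one of finitely many coordinates, and [U] selects one: the
    coordinate dropped by the projection. *)
Lemma dominant_coord (p : 'rV[R]_d.+1) :
  exists i, \forall t \near U, `|x t 0 i - p 0 i| = `|x t - p|.
Proof.
apply: (ultra_finite UU); apply: nearW => t.
by have [i <-] := rv_norm_attained (x t - p); exists i; rewrite !mxE.
Qed.

(** Central projection from the limit [p], with [q = (1, p)]. *)
Lemma near_indep_bounded (p : 'rV[R]_d.+1) : x @ U --> p ->
  near_iter U k.+3 (fun l => indep [seq homog (B t) | t <- l]).
Proof.
move=> xp; have [i xi] := dominant_coord p.
have thin : \forall t \near U, 4 * K * r t < `|x t - p|.
  have a0 : 0 < (4 * K)^-1 by rewrite invr_gt0 mulr_gt0.
  apply: filterS (thin_from_point UU Br mB p a0) => t.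
  by rewrite mulrC ltr_pdivlMr ?mulr_gt0// mulrC.
have far : \forall t \near U, forall y, B t y -> y 0 i != p 0 i.
  near=> t => y By.
  have Brt : round K e s (B t) (x t) (r t) by near: t.
  have rt : 4 * K * r t < `|x t - p| by near: t.
  have xit : `|x t 0 i - p 0 i| = `|x t - p| by near: t.
  have := central_bounds Brt xit rt By; rewrite -subr_eq0 -normr_gt0.
  have [_ r0 _ _ _] := Brt; have := mulr_ge0 (ltW K0) r0; lra.
apply: (@indep_step _ _ _ UU _ _ _ _ _ _ _ Br _ _ (centralg i p) (central i p) (1, p)).
- exact: centralg_linear.
- exact: centralg_center.
- by apply/eqP => -[] /eqP; rewrite oner_eq0.
- apply: filterS far => t Bt y /Bt yp.
  exists (y 0 i - p 0 i)^-1; last exact: centralgE.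
  by rewrite invr_eq0 subr_eq0.
- move=> a a0; near=> t => y By; exists 1; first exact: oner_neq0.
  rewrite scale1r; apply: pair_norm_lt; first by rewrite /= subrr normr0.
  have [_ r0 _ Bx _] : round K e s (B t) (x t) (r t) by near: t.
  have := Bx _ By; have : 4 * K * r t < `|x t - p| by near: t.
  have : `|p - x t| < a / 2.
    by near: t; move/cvgrPdist_lt: xp; apply; rewrite divr_gt0.
  have := ler_distD (x t) y p; have := mulr_ge0 (ltW K0) r0.
  rewrite (distrC p) /=; lra.
- apply: (IH (x := fun t => central i p (x t)) (r := fun t => r t / `|x t - p|)
      (K := 4 * K) (e := 1) (s := 1)) => //.
  + by rewrite (le_trans K1)// ler_peMl ?(ltW K0)// ler1n.
  + near=> t; apply: (@round_central _ _ _ K e s) => //; near: t; by [].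
  + move=> p' M; near=> t => _ [y By <-] yM.
    have yp : y 0 i != p 0 i by move: y By {yM}; near: t.
    move: (central_pflat yp yM); move: y By {yM yp}; near: t; exact: mB.
Unshelve. all: by end_near. Qed.

(** Parallel projection along the limit direction [u], with [q = (0, u)]. *)
Lemma near_indep_unbounded : (forall M, \forall t \near U, M < `|x t|) ->
  near_iter U k.+3 (fun l => indep [seq homog (B t) | t <- l]).
Proof.
move=> xM; have [i xi0] := dominant_coord 0.
have xi : \forall t \near U, `|x t 0 i| = `|x t|.
  by apply: filterS xi0 => t; rewrite mxE !subr0.
have xipos : \forall t \near U, x t 0 i != 0 /\ 0 < `|x t|.
  by apply: filterS2 xi (xM 0) => t xit x0; rewrite -normr_gt0 xit.
(* Dividing by the dominant coordinate makes coordinate [i] of the limit 1 and still keeps the norm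
   at most 1. *)
pose v t := (x t 0 i)^-1 *: x t.
have v1 : \forall t \near U, `|v t| <= 1.
  near=> t.
  have xit : `|x t 0 i| = `|x t| by near: t.
  have [_ x0] : x t 0 i != 0 /\ 0 < `|x t| by near: t.
  by rewrite normrZ normfV xit mulVf ?gt_eqF.
have [u vu] := ultra_bounded_cvg UU v1.
have ui : u 0 i = 1.
  apply/eqP; rewrite -subr_eq0 -normr_le0 leNgt; apply/negP => u0.
  have [t [[xi0t _]]] := filter_ex (filterI xipos (proj1 (cvgrPdist_lt _ _) vu _ u0)).
  rewrite ltNge (le_trans _ (rv_coord_le _ i))// !mxE mulVf//.
have u1 : `|u| <= 1.
  apply/ler_addgt0Pr => a a0.
  have [t [vt]] := filter_ex (filterI v1 (proj1 (cvgrPdist_lt _ _) vu _ a0)).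
  have := ler_distD (v t) u 0; rewrite !subr0; lra.
apply: (@indep_step _ _ _ UU _ _ _ _ _ _ _ Br _ _ (parallelg i u) (parallel i u) (0, u)).
- exact: parallelg_linear.
- exact: parallelg_center.
- by apply/eqP => -[] /(congr1 (fun w : 'rV_d.+1 => w 0 i));
  rewrite ui mxE => /eqP; rewrite oner_eq0.
- by apply: nearW => t y _; exists 1; [exact: oner_neq0|rewrite scale1r].
- move=> a a0; near=> t => y By.
  have [xit0 x0] : x t 0 i != 0 /\ 0 < `|x t| by near: t.
  have xit : `|x t 0 i| = `|x t| by near: t.
  exists (x t 0 i)^-1; first by rewrite invr_eq0.
  apply: pair_norm_lt => /=.
    rewrite subr0 /GRing.scale /= mulr1 normfV xit.
    by rewrite invf_plt ?posrE//; near: t; exact: xM.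
  have [_ r0 _ Bx _] : round K e s (B t) (x t) (r t) by near: t.
  have yx := Bx _ By.
  have uv : `|u - v t| < a / 2.
    by near: t; move/cvgrPdist_lt: vu; apply; rewrite divr_gt0.
  (* Seen from the origin the sets are small, so dividing by coordinate [i] of [x t] brings [y]
     close to [v t]. *)
  have rx : r t < a / 2 / K * `|x t - 0|.
    by near: t; apply: (thin_from_point UU Br mB); rewrite !divr_gt0.
  rewrite subr0 mulrAC ltr_pdivlMr// mulrC in rx.
  have := ler_distD (v t) ((x t 0 i)^-1 *: y) u; rewrite -scalerBr normrZ normfV xit (distrC (v t)).
  have : `|x t|^-1 * `|y - x t| < a / 2.
    by rewrite mulrC ltr_pdivrMr// (le_lt_trans yx).
  lra.
- apply: (IH (x := fun t => parallel i u (x t)) (r := r)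
      (K := 2 * K) (e := e) (s := 2 * s)) => //.
  + by rewrite (le_trans K1)// ler_peMl ?(ltW K0)// ler1n.
  + by apply: filterS Br => t; exact: round_parallel.
  + move=> p' M; near=> t => _ [y By <-] yM.
    move: (parallel_pflat ui yM); move: y By {yM}; near: t; exact: mB.
Unshelve. all: by end_near. Qed.

End Step.

Lemma near_indep d k : near_indep_at d k.
Proof.
elim: k d => [|k IHk] d B x r K e s K1 e0 Br mB; first exact: indep_points Br mB.
case: d => [|d] in B x Br mB *.
  (* In dimension 0, [B t] contains the only point, which it should miss. *)
  have [t [[_ r0 xB _ _] Bp]] := filter_ex (filterI Br (misses_point UU 0 mB)).
  by case: Bp; apply: xB; rewrite (_ : 0 - _ = 0) ?normr0 //; apply/rowP => -[].
have [xM|xM] := pselect (exists M, \forall t \near U, `|x t| <= M).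
  have [M] := xM; move=> /(ultra_bounded_cvg UU)[p xp].
  exact: (near_indep_bounded (IHk d) K1 Br mB xp).
apply: (near_indep_unbounded (IHk d) K1 e0 Br mB) => M.
have [h|] := ultra_orP UU (fun t => `|x t| <= M); first by case: xM; exists M.
by apply: filterS => t /negP; rewrite -ltNge.
Qed.

End NearIndependence.

(** * Inscribed and escribed Euclidean balls *)

Section EuclideanNorm.
Variables (R : realType) (d : nat).
Implicit Types (x y w : 'rV[R]_d) (B : set 'rV[R]_d).

Lemma enorm_ge0 x : 0 <= enorm x. Proof. exact: sqrtr_ge0. Qed.

Lemma sqr_sum_ge0 x : 0 <= \sum_(i < d) x 0 i ^+ 2.
Proof. by apply: sumr_ge0 => i _; exact: sqr_ge0. Qed.

Lemma enorm_sqr x : enorm x ^+ 2 = \sum_(i < d) x 0 i ^+ 2.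
Proof. exact/sqr_sqrtr/sqr_sum_ge0. Qed.

Lemma enormZ a x : enorm (a *: x) = `|a| * enorm x.
Proof.
rewrite /enorm; under eq_bigr do rewrite mxE exprMn.
by rewrite -mulr_sumr sqrtrM ?sqr_ge0// sqrtr_sqr.
Qed.

Lemma enorm0 : enorm (0 : 'rV[R]_d) = 0.
Proof. by rewrite -(scale0r 0) enormZ normr0 mul0r. Qed.

Lemma enormN x : enorm (- x) = enorm x.
Proof. by rewrite -scaleN1r enormZ normrN1 mul1r. Qed.

Lemma norm_le_enorm x : `|x| <= enorm x.
Proof.
apply/rv_norm_leP => [|i]; first exact: enorm_ge0.
rewrite -sqrtr_sqr ler_wsqrtr// (bigD1 i)//= lerDl.
by apply: sumr_ge0 => j _; exact: sqr_ge0.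
Qed.

Lemma enorm_le_norm x : enorm x <= d%:R * `|x|.
Proof.
rewrite -[leRHS]ger0_norm ?mulr_ge0// -sqrtr_sqr ler_wsqrtr//.
apply: (@le_trans _ _ (\sum_(i < d) `|x| ^+ 2)).
  apply: ler_sum => i _; rewrite -[leLHS]real_normK ?num_real//.
  by rewrite ler_pXn2r ?nnegrE// rv_coord_le.
rewrite sumr_const card_ord exprMn -[leLHS]mulr_natl ler_wpM2r ?sqr_ge0//.
by rewrite -natrX ler_nat; case: (d) => // n; rewrite -[leqLHS]muln1 leq_mul.
Qed.

Lemma enorm_eq0 x : enorm x <= 0 -> x = 0.
Proof.
by move=> x0; apply/eqP; rewrite -normr_le0 (le_trans (norm_le_enorm x)).
Qed.

Lemma ler_enormD x y : enorm (x + y) <= enorm x + enorm y.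
Proof.
have [/enorm_eq0 ->|x0] := lerP (enorm x) 0; first by rewrite add0r enorm0 add0r.
have [/enorm_eq0 ->|y0] := lerP (enorm y) 0; first by rewrite addr0 enorm0 addr0.
set a := enorm x in x0 *; set b := enorm y in y0 *.
rewrite -(@ler_pXn2r _ 2) ?nnegrE ?enorm_ge0 ?addr_ge0 ?(ltW x0) ?(ltW y0)//.
have xy : \sum_(i < d) x 0 i * y 0 i <= a * b.
  (* Cauchy-Schwarz: the sum equals [2 a b] times the difference of [a b] and the inner product. *)
  have : 0 <= \sum_(i < d) (b * x 0 i - a * y 0 i) ^+ 2.
    by apply: sumr_ge0 => i _; exact: sqr_ge0.
  have -> : \sum_(i < d) (b * x 0 i - a * y 0 i) ^+ 2 =
      b ^+ 2 * (\sum_(i < d) x 0 i ^+ 2) + a ^+ 2 * (\sum_(i < d) y 0 i ^+ 2)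
      - 2 * (a * b) * \sum_(i < d) x 0 i * y 0 i.
    rewrite !mulr_sumr -big_split -sumrB; apply: eq_bigr => i _ /=; ring.
  rewrite -!enorm_sqr -/a -/b => h.
  have ab : 0 < 2 * (a * b) by rewrite !mulr_gt0.
  rewrite -(ler_pM2l ab); lra.
rewrite enorm_sqr sqrrD -{1}/a /a /b !enorm_sqr.
rewrite (eq_bigr (fun i => x 0 i ^+ 2 + y 0 i ^+ 2 + 2 * (x 0 i * y 0 i))); last first.
  by move=> i _; rewrite mxE; ring.
rewrite !big_split -mulr_sumr /= -/a -/b; lra.
Qed.

Lemma enorm_continuous : continuous (@enorm R d).
Proof.
move=> x; have -> : continuous_at x (@enorm R d) = (@enorm R d @ nbhs x --> enorm x) by [].
apply/(@cvgrPdist_le _ _ _ (nbhs x)) => e e0.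
have e1 : 0 < e / d.+1%:R by rewrite divr_gt0.
have xn : \forall y \near x, `|x - y| <= e / d.+1%:R.
  by apply/nbhs_ballP; exists (e / d.+1%:R) => // y; rewrite -ball_normE => /ltW.
near=> y.
have xy : `|x - y| <= e / d.+1%:R by near: y.
have dxy : enorm (x - y) <= e.
  rewrite (le_trans (enorm_le_norm _))//.
  move: xy; rewrite ler_pdivlMr// mulrC => /(le_trans _); apply.
  by rewrite ler_wpM2r// ler_nat.
have := ler_enormD x (y - x); rewrite addrC subrK -(enormN (y - x)) opprB => yx.
have := ler_enormD y (x - y); rewrite addrC subrK => xy'.
by rewrite ler_norml; apply/andP; split; lra.
Unshelve. all: by end_near. Qed.

(** For fixed [w] the right-hand condition is closed in [(x, r)] when [B] is closed. *)
Lemma eball_subP x r B : 0 <= r ->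
  eball (x, r) `<=` B <-> forall w, enorm w <= 1 -> B (x + r *: w).
Proof.
move=> r0; split=> [xB w w1|xB y].
  by apply: xB; rewrite /eball /= addrAC subrr add0r enormZ ger0_norm// ler_piMr.
rewrite /eball /=; have [->|rn0] := eqVneq r 0.
  by move=> /enorm_eq0/subr0_eq->; have := xB 0; rewrite scaler0 addr0 enorm0; exact.
move=> yx; have := xB (r^-1 *: (y - x)).
rewrite scalerA divff// scale1r (addrC x) subrK; apply.
have rp : 0 < r by rewrite lt_neqAle eq_sym rn0.
by rewrite enormZ gtr0_norm ?invr_gt0// mulrC ler_pdivrMr// mul1r.
Qed.

End EuclideanNorm.

Section Inscribed.
Variables (R : realType) (d : nat) (B : set 'rV[R]_d.+1).
Hypotheses (cB : compact B) (B0 : B !=set0).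

Lemma compact_norm_bound : exists2 M : R, 0 <= M & forall y, B y -> `|y| <= M.
Proof.
have [M [_ BM]] := compact_bounded cB; have [b Bb] := B0.
have bM : forall y, B y -> `|y| <= M + 1 by apply: BM; rewrite ltrDl.
by exists (M + 1) => //; exact: le_trans (bM _ Bb).
Qed.

Lemma compact_pairs (S : set ('rV[R]_d.+1 * R)) M : closed S ->
  (forall u, S u -> B u.1 /\ 0 <= u.2 <= M) -> compact S.
Proof.
move=> clS SM; apply: (subclosed_compact clS (compact_setX cB (@segment_compact _ 0 M))).
by move=> u /SM[Bu uM]; split => //=; rewrite in_itv.
Qed.

Definition balls_in : set ('rV[R]_d.+1 * R) :=
  [set u | 0 <= u.2 /\ forall w, enorm w <= 1 -> B (u.1 + u.2 *: w)].

Lemma closed_balls_in : closed balls_in.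
Proof.
have -> : balls_in = [set u | 0 <= u.2] `&`
    \bigcap_(w in [set w | enorm w <= 1]) [set u | B (u.1 + u.2 *: w)].
  by apply/seteqP; split=> u [u0 uB]; split => // w; exact: uB.
apply: closedI.
  by apply: (@closed_comp _ _ snd [set t : R | 0 <= t]) => [u _|];
    [exact: cvg_snd|exact: closed_ge].
apply: closed_bigI => w _.
apply: (@closed_comp _ _ (fun u : 'rV[R]_d.+1 * R => u.1 + u.2 *: w) B) => [u _|].
  by apply: cvgD; [exact: cvg_fst|apply: cvgZr_tmp; exact: cvg_snd].
by apply: compact_closed cB; exact: norm_hausdorff.
Qed.

Lemma balls_in_bound M u : (forall y, B y -> `|y| <= M) -> balls_in u ->
  B u.1 /\ 0 <= u.2 <= 2 * M.
Proof.
move=> BM [u0 uB]; have Bu : B u.1.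
  by have := uB 0; rewrite scaler0 addr0 enorm0; exact.
split => //; rewrite u0 /=.
(* Both ends of a radius along the first axis lie in [B], so the radius is at most [2 * M]. *)
have : B (u.1 + u.2 *: delta_mx 0 0).
  apply: uB; rewrite /enorm (bigD1 0)//= big1 => [|i i0].
    by rewrite mxE eqxx addr0 expr1n sqrtr1.
  by rewrite mxE (negPf i0) expr0n.
move=> /BM uM; have := le_trans (rv_coord_le _ 0) uM.
have := le_trans (rv_coord_le _ 0) (BM _ Bu).
by rewrite !mxE !eqxx mulr1 !ler_norml => /andP[? ?] /andP[? ?]; lra.
Qed.

Lemma enorm_bound M x y : (forall y, B y -> `|y| <= M) -> B x -> B y ->
  enorm (y - x) <= d.+1%:R * (2 * M).
Proof.
move=> BM Bx By; rewrite (le_trans (enorm_le_norm _))// ler_wpM2l//.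
by rewrite (le_trans (ler_normB _ _))// mulrDl mul1r lerD ?BM.
Qed.

(** Two extremal problems on compact sets: the largest radius [rm] of a ball in [B], then, among the
    centres of balls of radius [rm] in [B], the least radius [rho] of an enclosing ball. *)
Lemma inscr_exists : exists D, is_inscr B D.
Proof.
have [M M0 BM] := compact_norm_bound; have [b Bb] := B0.
have inB D : 0 <= D.2 -> eball D `<=` B <-> balls_in D.
  by case: D => x r /= r0; rewrite (eball_subP x B r0) /balls_in /=; split=> // -[].
have cb : compact balls_in.
  by apply: (@compact_pairs _ (2 * M) closed_balls_in) => u; exact: balls_in_bound.
have nb : balls_in !=set0 by exists (b, 0); split=> //= w _; rewrite scale0r addr0.
have snd_cont (S : set ('rV[R]_d.+1 * R)) : {within S, continuous snd}.
  by apply: continuous_subspaceT => u; exact: cvg_snd.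
have [[x0 rm]] := compact_EVT_max nb cb (snd_cont _).
rewrite inE /= => xrm rmax.
(* Bounds all distances within [B]: capping the enclosing radii at [M'] loses no centre and makes
   [S] compact. *)
pose M' := d.+1%:R * (2 * M).
pose S := [set u : 'rV[R]_d.+1 * R | balls_in (u.1, rm)] `&`
  (\bigcap_(y in B) [set u | enorm (y - u.1) <= u.2]) `&` [set u | u.2 <= M'].
have clS : closed S.
  apply: closedI; [apply: closedI|].
  - apply: (@closed_comp _ _ (fun u : 'rV[R]_d.+1 * R => (u.1, rm)) balls_in) => [u _|].
      by apply: (@cvg_pair _ _ _ (nbhs u) (nbhs u.1) (nbhs rm)); [exact: cvg_fst|exact: cvg_cst].
    exact: closed_balls_in.
  - apply: closed_bigI => y _.
    rewrite (_ : [set u | _] = [set u : 'rV[R]_d.+1 * R | 0 <= u.2 - enorm (y - u.1)]); last first.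
      by apply/seteqP; split=> u /=; rewrite subr_ge0.
    apply: (@closed_comp _ _ (fun u : 'rV[R]_d.+1 * R => u.2 - enorm (y - u.1))
      [set t : R | 0 <= t]) => [u _|].
      apply: cvgB; first exact: cvg_snd.
      apply: (@continuous_comp _ _ _ (fun u : 'rV[R]_d.+1 * R => y - u.1) (@enorm R d.+1)).
        by apply: cvgB; [exact: cvg_cst|exact: cvg_fst].
      exact: enorm_continuous.
    exact: closed_ge.
  - by apply: (@closed_comp _ _ snd [set t : R | t <= M']) => [u _|];
      [exact: cvg_snd|exact: closed_le].
have cS : compact S.
  apply: (compact_pairs (M := M') clS) => u [[ub uy] uM].
  have [Bu _] := balls_in_bound BM ub; split => //; rewrite uM andbT.
  by rewrite (le_trans _ (uy _ Bb))// enorm_ge0.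
have SM' x : balls_in (x, rm) -> S (x, M').
  by move=> xb; split; last exact: lexx; split=> //= y By;
    apply: enorm_bound => //; have [] := balls_in_bound BM xb.
have nS : S !=set0 by exists (x0, M'); exact: SM'.
have [[x1 rho]] := compact_EVT_min nS cS (snd_cont _).
rewrite inE /= => -[[x1b x1y] /= rhoM] rhomin.
have rm0 : 0 <= rm by have [] := xrm.
have escr x : balls_in (x, rm) -> rho <= (escribed_at x B).2.
  move=> xb; apply: lb_le_inf.
    have [_ xM] := SM' _ xb; exists M'; split; first by rewrite !mulr_ge0.
    by move=> y By; have [[_ /(_ _ By)]] := SM' _ xb.
  move=> t [t0 Bt]; have [tM|/ltW Mt] := leP t M'; last exact: le_trans Mt.
  by apply: (rhomin (x, t)); rewrite inE; split => //; split => // y /Bt.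
exists (x1, rm); split; first split => //.
- exact/(inB (x1, rm)).
- by move=> D' D0 /inB-/(_ D0) D'b; apply: rmax; rewrite inE.
- move=> D' [D'0 D'B D'max]; have D'b : balls_in D' by exact/inB.
  have D'rm : D'.2 = rm.
    apply/le_anti; rewrite (rmax D') ?inE//= -[X in X <= _]/((x0, rm).2).
    by apply: D'max => //; exact/inB.
  apply: (@le_trans _ _ rho); last by apply: escr; rewrite -D'rm -surjective_pairing.
  apply: ge_inf; first by exists 0 => t [].
  split; first by rewrite (le_trans _ (x1y _ Bb))// enorm_ge0.
  by move=> y By; exact: x1y.
Qed.

Lemma inscrP : is_inscr B (inscr B).
Proof. by have [D DB] := inscr_exists; exact: getI DB. Qed.

(** The distance of [y] from the centre is a lower bound of the admissible radii, and such radii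
    exist since [B] is bounded. *)
Lemma sub_escribed y : B y -> enorm (y - (inscr B).1) <= (escribed B).2.
Proof.
move=> By; have [M M0 BM] := compact_norm_bound.
have Bx : B (inscr B).1.
  have [[r0 xB _] _] := inscrP; apply: xB; rewrite /eball /= subrr enorm0 //.
apply: lb_le_inf.
  exists (d.+1%:R * (2 * M)); split; first by rewrite !mulr_ge0.
  by move=> z Bz; exact: enorm_bound.
by move=> t [t0 /(_ _ By)].
Qed.

(* On the segment from the centre to a point of [B], retreating by at most
   [K + 1] reaches a point at distance at least 1 from the boundary of the
   inscribed ball. *)
Lemma round_inscr K : 1 <= K -> (escribed B).2 <= K * (inscr B).2 ->
  (escribed B).2 <= K + (inscr B).2 ->
  round (K * d.+1%:R) d.+1%:R^-1 (1 + K) B (inscr B).1 ((inscr B).2 / d.+1%:R).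
Proof.
move=> K1 EK EKD; have [[r0 xB _] _] := inscrP.
set x := (inscr B).1 in xB *; set r := (inscr B).2 in r0 xB EK EKD *.
have d0 : 0 < d.+1%:R :> R by [].
have hit w : enorm (w - x) <= r -> B w by exact: xB.
split => //.
- by rewrite divr_ge0.
- move=> y; rewrite ler_pdivlMr// mulrC => yx; apply: hit.
  exact: le_trans (enorm_le_norm _) yx.
- move=> y By; rewrite -mulrA (mulrC d.+1%:R) divfK ?gt_eqF//.
  by rewrite (le_trans (norm_le_enorm _))// (le_trans (sub_escribed By)).
rewrite ler_pdivlMr// mul1r => dr y By.
have r1 : 1 <= r by rewrite (le_trans _ dr)// ler1n.
have yx : enorm (y - x) <= r + K by rewrite (le_trans (sub_escribed By))// addrC.
have rK : 0 < r + K by lra.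
pose a := (r - 1) / (r + K).
have aE : a * (r + K) = r - 1 by rewrite divfK ?gt_eqF.
have a0 : 0 <= a by rewrite divr_ge0// ?subr_ge0// ltW.
have a1 : a <= 1 by rewrite ler_pdivrMr// mul1r; lra.
exists (x + a *: (y - x)).
  rewrite (le_trans (norm_le_enorm _))//.
  have -> : x + a *: (y - x) - y = (a - 1) *: (y - x).
    by apply/rowP => i; rewrite !mxE; ring.
  rewrite enormZ ler0_norm ?subr_le0// opprB.
  have := ler_wpM2l (_ : 0 <= 1 - a) yx; rewrite subr_ge0 => /(_ a1); lra.
move=> w wz; apply: hit.
have -> : w - x = (w - (x + a *: (y - x))) + a *: (y - x).
  by apply/rowP => i; rewrite !mxE; ring.
rewrite (le_trans (ler_enormD _ _))// enormZ (ger0_norm a0).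
have : enorm (w - (x + a *: (y - x))) <= 1.
  rewrite (le_trans (enorm_le_norm _))//.
  by have := ler_wpM2l (ltW d0) wz; rewrite divff ?gt_eqF.
have := ler_wpM2l a0 yx; lra.
Qed.

End Inscribed.

(** * Flats and the choice of the ultrafilter *)

Lemma vspace_extend (K : fieldType) (vT : vectType K) (V : {vspace vT}) k :
  (\dim V <= k)%N -> (k <= \dim {:vT})%N ->
  exists2 W : {vspace vT}, (V <= W)%VS & \dim W = k.
Proof.
move=> Vk kd; have [n] := ubnP (k - \dim V); elim: n V Vk => // n IHn V Vk kV.
have [VkE|Vlt] := eqVneq (\dim V) k; first by exists V.
have [v vV] : exists v, v \notin V.
  apply: contrapT => /forallNP VT; have : (fullv <= V)%VS.
    by apply/subvP => v _; apply: contrapT => /negP; exact: VT.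
  by move=> /dimvS; lia.
have dV : \dim (V + <[v]>)%VS = (\dim V).+1.
  rewrite dimv_disjoint_sum ?dim_vline.
    by rewrite (_ : v != 0) ?addn1//; apply: contra vV => /eqP->; exact: mem0v.
  apply/eqP; rewrite -subv0; apply/subvP => w /memv_capP[wV /vlineP[a wa]].
  move: wV; rewrite wa memv0; have [->|a0] := eqVneq a 0; first by rewrite scale0r.
  move=> /(memvZ a^-1); rewrite scalerA mulVf// scale1r => Vv.
  by rewrite Vv in vV.
have [||W VW Wk] := IHn (V + <[v]>)%VS; rewrite ?dV; [lia|lia|].
by exists W => //; exact: subv_trans (addvSl _ _) VW.
Qed.

(** The span of the rows may have dimension below [k] and is then extended. *)
Lemma pflat_sub_flat (R : realType) d k (p : 'rV[R]_d) (M : 'M[R]_(k, d)) :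
  (k <= d)%N -> exists2 L, flat k L & pflat p M `<=` L.
Proof.
move=> kd; pose V := (<<[tuple row i M | i < k]>>)%VS.
have [||W VW Wk] := @vspace_extend _ _ V k.
- by rewrite (leq_trans (dim_span _))// size_tuple.
- by rewrite dimvf /dim /= mul1n.
exists [set p + v | v in [set` W]]; first by exists p, W.
move=> _ [a _ <-]; exists (a *m M) => //=; apply: (subvP VW).
rewrite mulmx_sum_row; apply: memv_suml => i _; apply: memvZ; apply: memv_span.
by apply/mapP; exists i => //; rewrite mem_enum.
Qed.

(** Otherwise the [k + 1] differences of [k + 2] points of the flat would be free in a space of
    dimension [k]. *)
Lemma flat_not_indep (R : realType) d k (L : set 'rV[R]_d) (l : seq (set 'rV[R]_d)) :
  flat k L -> size l = k.+2 -> (forall A, A \in l -> pierced A L) ->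
  ~ indep (map (@homog R d) l).
Proof.
move=> [p [V [dV LE]]] szl Al li.
have /choice[v vP] : forall j, exists v, (j < k.+2)%N -> v \in V /\ nth set0 l j (p + v).
  move=> j; case: (ltnP j k.+2) => [jk|]; last by exists 0.
  have [y [yl]] : pierced (nth set0 l j) L by apply/Al/mem_nth; rewrite szl.
  by rewrite LE => -[v vV vy]; exists v; rewrite vy.
pose X := [tuple v i.+1 - v 0 | i < k.+1].
have : free X.
  apply/freeP => a aX i.
  (* These coefficients sum to 0, so a relation between differences becomes one between homogeneous
     vectors. *)
  pose c j := if j is j'.+1 then a (inord j') else - \sum_i a i.
  have c0 : forall j, (j < size (map (@homog R d) l))%N -> c j = 0.
    apply: (li (fun j => (1, p + v j))).
      move=> j; rewrite size_map => jl; rewrite (nth_map set0)//.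
      by exists (p + v j) => //; apply: (vP _ _).2; rewrite -szl.
    rewrite size_map szl big_ord_recl /= scaleNr scaler_suml -sumrN -big_split /=.
    pose h (w : 'rV[R]_d) : R^o * 'rV[R]_d := (0, w).
    have hD : {morph h : u w / u + w} by move=> u w; congr pair; rewrite addr0.
    rewrite -[RHS]/(h 0) -aX (big_morph h hD erefl); apply: eq_bigr => i0 _.
    rewrite /bump /= add1n inord_val addrC -scalerBr; congr pair => /=.
      by rewrite subrr scaler0.
    rewrite (nth_map i0) ?size_enum_ord// nth_ord_enum.
    by rewrite opprD addrACA subrr add0r.
  by have := c0 i.+1; rewrite size_map szl ltnS ltn_ord /= inord_val; exact.
rewrite /free size_tuple => /eqP XE.
have : (<<X>> <= V)%VS.
  apply/span_subvP => w /mapP[i _ ->]; apply: memvB; apply: (vP _ _).1 => //.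
  by rewrite ltnS ltn_ord.
by move=> /dimvS; rewrite XE dV ltnn.
Qed.

(** If the two sets were equal, the same point could be chosen in both, which is a dependency. *)
Lemma indep_nth_inj (R : realType) d (l : seq (set 'rV[R]_d)) i j :
  indep (map (@homog R d) l) -> (forall A, A \in l -> A !=set0) ->
  (i < j < size l)%N -> nth set0 l i <> nth set0 l j.
Proof.
move=> li l0 /andP[ij jl] lij.
have il := ltn_trans ij jl.
have /choice[y yP] : forall n, exists y, (n < size l)%N -> nth set0 l n y.
  move=> n; case: (ltnP n (size l)) => [nl|]; last by exists 0.
  by have [y] := l0 _ (mem_nth set0 nl); exists y.
pose z n := if n == j then y i else y n.
pose c n : R := (n == i)%:R - (n == j)%:R.
suff : c i = 0.
  by rewrite /c eqxx (ltn_eqF ij) subr0 => /eqP; rewrite oner_eq0.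
apply: (li (fun n => (1, z n))); rewrite ?size_map//.
  move=> n nl; rewrite (nth_map set0)//; exists (z n) => //; rewrite /z.
  by case: eqP => [->|_]; [rewrite -lij|]; exact: yP.
rewrite (bigD1 (Ordinal il)) //= (bigD1 (Ordinal jl)) /=; last first.
  by rewrite -val_eqE /= gtn_eqF.
rewrite big1 ?addr0 => [|n /andP[ni nj]].
  rewrite /c /z !eqxx (ltn_eqF ij) (gtn_eqF ij) subr0 sub0r.
  by rewrite scaleN1r scale1r subrr.
by move: ni nj; rewrite -!val_eqE /c /= => /negPf-> /negPf->; rewrite subrr scale0r.
Qed.

Lemma card_I_enum (T : pointedType) (H : set T) n : (H #= `I_n)%card ->
  exists g : nat -> T, (forall i, (i < n)%N -> H (g i)) /\
    (forall i j, (i < n)%N -> (j < n)%N -> g i = g j -> i = j).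
Proof.
move=> /card_esym/card_set_bijP[g [gH ginj _]]; exists g; split=> // i j i_n j_n.
by apply: ginj; rewrite inE.
Qed.

(** * The filter of members avoiding finitely many flats, and the conclusion *)

Section Final.
Variables (R : realType) (d k : nat) (F : set (set 'rV[R]_d)).

Definition avoiding : set_system (set 'rV[R]_d) :=
  [set A | exists s : seq ('rV[R]_d * 'M[R]_(k, d)),
    forall B, F B -> (forall q, q \in s -> forall y, B y -> ~ pflat q.1 q.2 y) -> A B].

Lemma avoiding_filter : Filter avoiding.
Proof.
split; first by exists [::].
- move=> A A' [s sA] [s' sA']; exists (s ++ s') => B FB ss.
  by split; [apply: sA|apply: sA'] => // q qs; apply: ss; rewrite mem_cat qs ?orbT.
- by move=> A A' AA' [s sA]; exists s => B FB sB; exact/AA'/sA.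
Qed.

(** If the filter contained the empty set, finitely many [pflat]s would pierce all of [F]; each is
    enlarged to a flat. *)
Lemma avoiding_proper : (k <= d)%N ->
  ~ (exists T : set (set 'rV[R]_d), [/\ finite_set T,
        forall L, T L -> flat k L &
        forall B, F B -> exists2 L, T L & pierced B L]) ->
  ProperFilter avoiding.
Proof.
move=> kd noT; split; last exact: avoiding_filter.
move=> [s sF]; apply: noT.
have /choice[L LP] : forall q : 'rV[R]_d * 'M[R]_(k, d),
    exists L, flat k L /\ pflat q.1 q.2 `<=` L.
  by move=> q; have [L] := pflat_sub_flat q.1 q.2 kd; exists L.
exists (L @` [set` s]); split.
- exact/finite_image/finite_seq.
- by move=> _ [q _ <-]; have [] := LP q.
- move=> B FB; apply: contrapT => nB; apply: (sF _ FB) => q qs y By yq.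
  apply: nB; exists (L q); first by exists q.
  by exists y; split => //; have [_] := LP q; exact.
Qed.

End Final.

Theorem theorem1p4 (R : realType) (d k : nat) (hd : (1 <= d)%N)
  (hk : (k <= d - 1)%N) (F : set (set 'rV[R]_d))
  (hFinf : infinite_set F)
  (hFcpt : forall B, F B -> compact B)
  (hFnear : near_balls F)
  (hFprop : aleph0_property k k.+2 F) :
  exists T : set (set 'rV[R]_d),
    [/\ finite_set T,
        forall L, T L -> flat k L &
        forall B, F B -> exists2 L, T L & pierced B L].
Proof.
apply: contrapT => noT; have kd : (k <= d)%N by lia.
have /ultraFilterLemma[U [UU FU]] := avoiding_proper kd noT.
have UF : \forall B \near U, F B by apply: FU; exists [::].
case: d hd hk F hFinf hFcpt hFnear hFprop noT kd U UU FU UF =>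
  // d' _ _ {}F _ Fcpt [F0 [K FK]] Fprop noT kd U UU FU UF.
(* [round_inscr] requires a constant at least 1; both near-ball conditions survive its
   enlargement. *)
pose K' := Num.max 1 K.
have Fround : \forall B \near U, round (K' * d'.+1%:R) d'.+1%:R^-1 (1 + K') B
    (inscr B).1 ((inscr B).2 / d'.+1%:R).
  apply: filterS UF => B FB; have [KB KB'] := FK _ FB.
  have [[r0 _ _] _] := inscrP (Fcpt _ FB) (F0 _ FB).
  apply: (round_inscr (Fcpt _ FB) (F0 _ FB)); first by rewrite /K' le_max lexx.
    by rewrite (le_trans KB)// ler_wpM2r// /K' le_max lexx orbT.
  by rewrite (le_trans KB')// lerD2r /K' le_max lexx orbT.
have miss : misses U k (fun B : set 'rV[R]_d'.+1 => B).
  move=> p M; apply: FU; exists [:: (p, M)] => B FB /(_ (p, M)).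
  by apply; rewrite inE.
have K1 : 1 <= K' * d'.+1%:R by rewrite -[X in X <= _]mulr1 ler_pM ?ler1n// /K' le_max lexx.
have e0 : 0 < d'.+1%:R^-1 :> R by rewrite invr_gt0.
have Uind := near_indep UU K1 e0 Fround miss.
have {Uind} : near_iter U k.+2 (fun l => (forall A, A \in l -> F A) /\
    indep (map (@homog R d'.+1) l)).
  by apply: (near_iter_impl _ UF _ Uind) => l _ lF li; split.
move=> /near_iter_sequence[f fP].
have sorted_iota n : sorted ltn (iota n k.+2) by exact: iota_ltn_sorted.
have fF n : F (f n).
  have [+ _] := fP (iota n k.+2) (sorted_iota n) (size_iota _ _).
  by apply; rewrite /= inE eqxx.
(* Indices [m < n] begin an increasing list of length [k + 2], whose sets are independent, hence
   distinct. So [range f] is countably infinite. *)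
have finj m n : (m < n)%N -> f m <> f n.
  move=> mn; have [||_ ind] := fP (m :: iota n k.+1).
  - by rewrite /= mn /=; exact: (iota_ltn_sorted n k.+1).
  - by rewrite /= size_iota.
  - apply: (@indep_nth_inj _ _ _ 0 1 ind) => //= A.
    by move=> /(@mapP _ _ f (m :: iota n k.+1))[i _ ->]; exact: F0.
have [||H [HG Hk [L Lk HL]]] := Fprop (range f).
- by move=> _ [n _ <-].
- apply: (@inj_card_eq _ _ [set: nat] f) => m n _ _ fmn.
  by case: (ltngtP m n) => // /finj; rewrite fmn.
have [g [gH ginj]] := card_I_enum Hk.
have /choice[m mP] : forall i, exists n, (i < k.+2)%N -> f n = g i.
  move=> i; case: (ltnP i k.+2) => [/gH/HG[n _ <-]|]; last by exists 0%N.
  by exists n.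
(* [fP] concerns increasing lists, so the indices of the pierced sets are sorted. *)
pose s := sort leq (map m (iota 0 k.+2)).
have [||sF ind] := fP s.
- rewrite ltn_sorted_uniq_leq sort_uniq sort_sorted ?andbT; last exact: leq_total.
  rewrite map_inj_in_uniq ?iota_uniq// => i j.
  rewrite !mem_iota /= !add0n => ik jk mij.
  by apply: ginj => //; rewrite -!mP// mij.
- by rewrite size_sort size_map size_iota.
apply: flat_not_indep Lk _ _ ind; first by rewrite size_map size_sort size_map size_iota.
move=> A /mapP[n]; rewrite mem_sort => /mapP[i]; rewrite mem_iota /= add0n => ik -> ->.
by apply: HL; rewrite mP//; exact: gH.
Qed.
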